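(* Assume $\mathrm{MA}_{\omega_1}(\mathrm{ctble})$. Then for every countable ordinal $\alpha<\omega_1$ there is a Borel subset of $2^\omega$ (in the ordinary sense) which is not $\Sigma^*_\alpha$.
   Context: $\mathrm{MA}_{\omega_1}(\mathrm{ctble})$ is Martin's Axiom for countable posets and $\omega_1$ dense sets: for every countable poset and every family of $\omega_1$ dense subsets of it there is a filter meeting all of them. The $\omega_1$-Borel hierarchy on $2^\omega$: $\Sigma^*_0=\Pi^*_0=$ clopen sets; for $\alpha>0$, $\Sigma^*_\alpha$ is the family of unions $\bigcup_{\beta<\omega_1}A_\beta$ with each $A_\beta\in\bigcup_{\gamma<\alpha}\Pi^*_\gamma$, and $\Pi^*_\alpha$ is the family of intersections $\bigcap_{\beta<\omega_1}A_\beta$ with each $A_\beta\in\bigcup_{\gamma<\alpha}\Sigma^*_\gamma$. *)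

(* Defs.v *)
From mathcomp Require Import all_boot all_order.
From mathcomp Require Import all_classical all_reals all_analysis.
From mathcomp Require wochoice.

Set Implicit Arguments.
Unset Strict Implicit.
Unset Printing Implicit Defensive.

Import Order.TTheory.
Local Open Scope classical_set_scope.

(* [W], ordered by the non-strict relation [R], has order type omega_1; the
   countable ordinals are then the elements of [W]. Any two such orders are
   isomorphic, and [omega1_exists] below provides one. *)
Definition is_omega1 (W : Type) (R : rel W) : Prop :=
  [/\ wochoice.well_order R,
      ~ countable [set: W] &
      forall a : W, countable [set b | R b a]].

Section Posets.
Context {d : Order.disp_t} {P : porderType d}.
Local Open Scope order_scope.

(* Forcing convention: smaller elements are stronger conditions. *)
Definition poset_dense (D : set P) : Prop :=
  forall p : P, exists2 q : P, D q & q <= p.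

Definition poset_filter (G : set P) : Prop :=
  [/\ G !=set0,
      forall p q : P, G p -> p <= q -> G q &
      forall p q : P, G p -> G q -> exists r : P, [/\ G r, r <= p & r <= q]].

End Posets.

(* [W] only serves as an index set of cardinality aleph_1. Posets are nonempty:
   the empty poset has no filter at all. *)
Definition MA_ctble (W : Type) : Prop :=
  forall (d : Order.disp_t) (P : porderType d),
    [set: P] !=set0 -> countable [set: P] ->
  forall D : W -> set P, (forall b : W, poset_dense (D b)) ->
  exists2 G : set P, poset_filter G & forall b : W, (G `&` D b) !=set0.

Section OmegaOneBorel.
Context {W : Type} (R : rel W).

Definition ord_zero (a : W) : Prop := forall b : W, R a b.

Definition ord_lt (a b : W) : Prop := R a b /\ a <> b.

Inductive SigmaStar : W -> set cantor_space -> Prop :=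
| SigmaStar0 (a : W) (A : set cantor_space) :
    ord_zero a -> clopen A -> SigmaStar a A
| SigmaStarU (a : W) (A : W -> set cantor_space) :
    ~ ord_zero a ->
    (forall b : W, exists2 c : W, ord_lt c a & PiStar c (A b)) ->
    SigmaStar a (\bigcup_b A b)
with PiStar : W -> set cantor_space -> Prop :=
| PiStar0 (a : W) (A : set cantor_space) :
    ord_zero a -> clopen A -> PiStar a A
| PiStarI (a : W) (A : W -> set cantor_space) :
    ~ ord_zero a ->
    (forall b : W, exists2 c : W, ord_lt c a & SigmaStar c (A b)) ->
    PiStar a (\bigcap_b A b).

End OmegaOneBorel.

Definition is_borel {T : topologicalType} (B : set T) : Prop :=
  <<s [set U : set T | open U] >> B.

Lemma uncountable_set_nat : ~ countable [set: set nat].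
Proof.
move=> /countable_injP[f finj].
pose S : set nat := [set n | exists2 X, f X = n & ~ X n].
have Sf : S (f S) <-> ~ S (f S).
  split=> [[X fX nX]|nS]; last by exists S.
  by have <- : X = S; [apply: finj; rewrite ?inE | rewrite fX].
have nS : ~ S (f S) by move=> h; exact: (Sf.1 h h).
exact: nS (Sf.2 nS).
Qed.

(* In a well-order of the power set of nat, the elements with countably many
   predecessors have order type omega_1. *)
Lemma omega1_exists : exists (W : Type) (R : rel W), is_omega1 R.
Proof.
have [R Rwo] := wochoice.well_ordering_principle {classic set nat}.
have Rwot : wochoice.wo_chain R predT by move=> A _; exact: Rwo.
have Ranti x y : R x y -> R y x -> x = y.
  by move=> xy yx; apply: (wochoice.wo_chain_antisymmetric Rwot) => //;
     rewrite xy yx.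
pose I : set {classic set nat} := [set x | countable [set y | R y x]].
pose W := {x | I x}.
have sinj : injective (@sval _ I).
  by move=> [x Ix] [y Iy] /= xy; exact: eq_exist.
exists W, (fun a b => R (sval a) (sval b)); split.
- move=> A [a Aa].
  pose B : {pred {classic set nat}} :=
    [pred x | `[< exists2 b : W, b \in A & sval b = x >]].
  have [|z [[zB zmin] _]] := Rwo B; first by exists (sval a); apply/asboolP; exists a.
  have /asboolP[b Ab bz] := zB.
  have bmin : forall c, c \in A -> R (sval b) (sval c).
    by move=> c Ac; rewrite bz; apply: zmin; apply/asboolP; exists c.
  exists b; split; first by split.
  move=> c [Ac cmin]; apply: sinj; apply: Ranti; first exact: bmin.
  exact: cmin.
- move=> cW.
  have cI : countable I.
    apply: (@sub_countable _ _ _ [set: W]) => //.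
    apply: (card_le_trans _ (card_image_le (@sval _ I) [set: W])).
    by apply: subset_card_le => x Ix; exists (exist _ x Ix).
  pose B : {pred {classic set nat}} := [pred x | `[< ~ I x >]].
  have [|z [[/asboolP zI zmin] _]] := Rwo B.
    apply: contrapT => nB; apply: uncountable_set_nat.
    apply: sub_countable cI; apply: subset_card_le => x _.
    by apply: contrapT => nIx; apply: nB; exists x; apply/asboolP.
  apply: zI; apply: (@sub_countable _ _ _ (I `|` [set z])).
    apply: subset_card_le => y Ryz; have [Iy|nIy] := pselect (I y); first by left.
    by right; apply: Ranti => //; apply: zmin; apply/asboolP.
  rewrite -bigcup2E; apply: bigcup_countable => // -[|[|n]] _ //=.
- move=> [x Ix] /=.
  have /countable_injP[f finj] := Ix.
  apply/countable_injP; exists (f \o sval) => b c.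
  rewrite !inE /= => bx cx fbc.
  by apply: sinj; apply: finj => //; rewrite inE.
Qed.

(* Main.v *)
(* Steel forcing. A generic increasing forest on the natural numbers is built
   from finite conditions that attach to each node a tag, an ordinal below
   [omega * (s + 1)] or infinity, decreasing along edges; for a generic branch
   the finite tags are exactly the ranks of the nodes. Two conditions with the
   same edges whose tags agree as far as they lie below [omega * (c + 1)] force
   the same [Pi*_c] sets, by a back-and-forth (retagging) induction on [c]. With
   [a < s], the one-node conditions tagged [omega * s] and infinity are
   indistinguishable for [Pi*_a] sets, yet they decide oppositely the Borel set
   of codes whose node 0 has rank at most [omega * s].
   There are only countably many conditions, and [MA_ctble] provides branches
   generic for the aleph_1 dense sets that decide an omega_1-Borel set. *)
From HB Require Import structures.
Require Import Defs.
From mathcomp Require Import all_boot all_order.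
From mathcomp Require Import all_classical all_reals all_analysis.

Set Implicit Arguments.
Unset Strict Implicit.
Unset Printing Implicit Defensive.

Import Order.TTheory.
Local Open Scope classical_set_scope.

(** * The order type omega_1 *)

Section Omega1Order.
Context {W : Type} {R : rel W} (hW : is_omega1 R).

Lemma omega1_min (A : set W) : A !=set0 -> exists2 z, A z & forall x, A x -> R z x.
Proof.
move=> [x Ax]; have [wo _ _] := hW.
have [|z [[/asboolP Az zmin] _]] := wo [pred x | `[< A x >]].
  by exists x; apply/asboolP.
by exists z => // y Ay; apply: zmin; apply/asboolP.
Qed.

Lemma omega1_refl a : R a a.
Proof. by have [|z -> ->//] := @omega1_min [set a]; first by exists a. Qed.

Lemma omega1_total a b : R a b || R b a.
Proof.
have [|z [->|->] h] := @omega1_min [set a; b]; first by exists a; left.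
- by rewrite (h b) //; right.
- by rewrite (h a) ?orbT //; left.
Qed.

Lemma omega1_anti a b : R a b -> R b a -> a = b.
Proof.
move=> ab ba; have [wo _ _] := hW.
have [|z [_ zu]] := wo [pred x | `[< x = a \/ x = b >]].
  by exists a; apply/asboolP; left.
have <- : z = a.
  apply: zu; split; first by apply/asboolP; left.
  by move=> x /asboolP[->|->] //; exact: omega1_refl.
apply: zu; split; first by apply/asboolP; right.
by move=> x /asboolP[->|->] //; exact: omega1_refl.
Qed.

Lemma omega1_trans a b c : R a b -> R b c -> R a c.
Proof.
move=> ab bc.
have [|z zE h] := @omega1_min [set x | [\/ x = a, x = b | x = c]].
  by exists a; apply: Or31.
have ha := h a (Or31 _ _ erefl); have hb := h b (Or32 _ _ erefl).
have hc := h c (Or33 _ _ erefl).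
case: zE hc hb ha => -> // hc hb ha; first by rewrite (omega1_anti ab ha).
by rewrite (omega1_anti hb bc).
Qed.

Lemma omega1_ltNge a b : ord_lt R a b <-> ~ R b a.
Proof.
split=> [[ab nab] ba|nba]; first by apply: nab; exact: omega1_anti.
split; first by have /orP[] := omega1_total a b.
by move=> ab; apply: nba; rewrite ab; exact: omega1_refl.
Qed.

Lemma omega1_le_lt_trans a b c : R a b -> ord_lt R b c -> ord_lt R a c.
Proof.
move=> ab /omega1_ltNge nbc; apply/omega1_ltNge => ca.
by apply: nbc; apply: omega1_trans ab.
Qed.

Lemma omega1_lt_le_trans a b c : ord_lt R a b -> R b c -> ord_lt R a c.
Proof.
move=> /omega1_ltNge nab bc; apply/omega1_ltNge => ca.
by apply: nab; apply: omega1_trans ca.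
Qed.

Lemma omega1_wf : well_founded (ord_lt R).
Proof.
move=> a; apply: contrapT => na.
have [|z nz zmin] := @omega1_min [set x | ~ Acc (ord_lt R) x]; first by exists a.
apply: nz; constructor => y /omega1_ltNge yz.
by apply: contrapT => /zmin.
Qed.

(** If nothing lay above [a], all of [W] would be the countable segment below [a]. *)
Lemma omega1_succ a : exists2 b, ord_lt R a b & forall c, ord_lt R a c -> R b c.
Proof.
apply: omega1_min; apply: contrapT => na; have [_ unc cnt] := hW.
apply: unc; apply: (sub_countable _ (cnt a)); apply: subset_card_le => b _ /=.
by apply: contrapT => /omega1_ltNge ab; apply: na; exists b.
Qed.

(* Writing [s] for the successor, each element of [W] is uniquely [s^n l] with
   [l] not a successor; decoding [n] as a pair gives the surjection. *)
Lemma omega1_setX_nat : exists f : W -> W * nat, forall z, exists w, f w = z.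
Proof.
have /choice[s sP] : forall a, exists b, ord_lt R a b /\ forall c, ord_lt R a c -> R b c.
  by move=> a; have [b ab bmin] := omega1_succ a; exists b.
have sinj : injective s.
  have slt a b : ord_lt R a b -> s a <> s b.
    move=> ab sab; have [_ /(_ b ab)] := sP a.
    by rewrite sab; apply/omega1_ltNge; have [] := sP b.
  move=> a b sab; apply: contrapT => nab.
  by have /orP[h|h] := omega1_total a b; [case: (@slt a b)|case: (@slt b a)] => //;
    split=> // /esym.
have dec w : exists z : W * nat, iter z.2 s z.1 = w /\ forall v, s v <> z.1.
  elim/(well_founded_ind omega1_wf): w => w IH.
  have [[v vw]|nv] := pselect (exists v, s v = w); last first.
    by exists (w, 0); split=> // v vw; apply: nv; exists v.
  have [|z [zv zlim]] := IH v; first by rewrite -vw; have [] := sP v.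
  by exists (z.1, z.2.+1); rewrite /= zv.
have dec_uniq m n l l' : (forall v, s v <> l) -> (forall v, s v <> l') ->
    iter m s l = iter n s l' -> m = n /\ l = l'.
  move=> hl hl'; elim: m n => [|m IH] [|n] //=.
  - by move/esym/hl.
  - by move/hl'.
  - by move=> /sinj /IH[-> ->].
have /choice[g gP] := dec.
pose f w := let: (m, k) := odflt (0, 0) (unpickle (g w).2) in (iter m s (g w).1, k).
exists f => -[w k]; have [[l m] /= [lw llim]] := dec w.
exists (iter (pickle (m, k)) s l); rewrite /f.
have [glw glim] := gP (iter (pickle (m, k)) s l).
by have [-> ->] := dec_uniq _ _ _ _ glim llim glw; rewrite pickleK /= lw.
Qed.

(** A pair is coded by its larger coordinate [c], the place of the other one in an enumeration of
    the countable segment below [c], and a bit telling which is which; place and bit make one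
    natural number. *)
Lemma omega1_setX : exists f : W -> W * W, forall z, exists w, f w = z.
Proof.
have [f fsurj] := omega1_setX_nat.
have esurj c : exists e : nat -> W, forall b, R b c -> exists n, e n = b.
  have [_ _ /(_ c) /countable_injP[g ginj]] := hW.
  have /choice[e eP] n : exists b, (exists2 b', R b' c & g b' = n) -> R b c /\ g b = n.
    have [[b bc gb]|nb] := pselect (exists2 b, R b c & g b = n); first by exists b.
    by exists c.
  exists e => b bc; exists (g b).
  by have [|h1 h2] := eP (g b); [exists b | apply: ginj; rewrite ?inE].
have /choice[e eP] := esurj.
pose F w := let: (c, n) := f w in
  let: (t, k) := odflt (true, 0) (unpickle n) in
  if t then (c, e c k) else (e c k, c).
exists F => -[a b]; have /orP[ab|ba] := omega1_total a b.
- have [k ek] := eP b a ab; have [w fw] := fsurj (b, pickle (false, k)).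
  by exists w; rewrite /F fw pickleK /= ek.
- have [k ek] := eP a b ba; have [w fw] := fsurj (a, pickle (true, k)).
  by exists w; rewrite /F fw pickleK /= ek.
Qed.

End Omega1Order.

(** * Generic branches and forcing *)

Definition condition (T : Type) (V : pred (seq T)) : Type := {s : seq T | V s}.

HB.instance Definition _ (T : countType) (V : pred (seq T)) :=
  Countable.on (condition V).

Section Conditions.
Context {T : countType} {V : pred (seq T)}.

Definition extends (p q : condition V) : bool := prefix (val q) (val p).

Lemma extends_refl : reflexive extends.
Proof. by move=> p; exact: prefix_refl. Qed.

Lemma extends_anti : antisymmetric extends.
Proof.
move=> p q /andP[]; rewrite /extends !prefixE => /eqP pq /eqP qp; apply: val_inj.
have [le|/ltnW le] := leqP (size (val p)) (size (val q)).
  by rewrite -[LHS](take_oversize le).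
by rewrite -[RHS](take_oversize le).
Qed.

Lemma extends_trans : transitive extends.
Proof. by move=> q p r pq qr; exact: prefix_trans qr pq. Qed.

HB.instance Definition _ := Order.Le_isPOrder.Build (Order.Disp tt tt) (condition V)
  extends_refl extends_anti extends_trans.

End Conditions.

Lemma prefix_nth (T : eqType) (x0 : T) (s t : seq T) i :
  i < size s -> prefix s t -> nth x0 t i = nth x0 s i.
Proof. by move=> si /prefixP[t' ->]; rewrite nth_cat si. Qed.

Section GenericBranches.
Context (W : Type) {R : rel W} (hW : is_omega1 R) (hMA : MA_ctble W).
Context {T : countType} (V : pred (seq T)).
Hypothesis Vtake : forall n s, V s -> V (take n s).
Hypothesis Vrcons : forall s, V s -> exists x, V (rcons s x).

Definition branch (g : nat -> T) : Prop := forall n, V (mkseq g n).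

Definition dense_in (D : set (seq T)) : Prop :=
  forall p, V p -> exists q, [/\ V q, prefix p q & D q].

Lemma omega1_inh : exists w : W, True.
Proof.
have [_ unc _] := hW; apply: contrapT => nw; apply: unc.
by rewrite (_ : [set: W] = set0) // -subset0 => w _; apply: nw; exists w.
Qed.

Lemma ext_size n p : V p -> exists q, [/\ V q, prefix p q & n <= size q].
Proof.
move=> Vp; elim: n => [|n [q [Vq pq nq]]]; first by exists p; rewrite prefix_refl.
have [x Vqx] := Vrcons Vq; exists (rcons q x); split=> //.
  by apply: prefix_trans pq _; exact: prefix_rcons.
by rewrite size_rcons ltnS.
Qed.

(** The axiom is applied to the poset of valid extensions of [p]; the filter glues to one infinite
    sequence. *)
Lemma generic_branch (D : W -> set (seq T)) p : V p -> (forall b, dense_in (D b)) ->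
  exists g, [/\ branch g, mkseq g (size p) = p & forall b, exists n, D b (mkseq g n)].
Proof.
move=> Vp Dd; have [f fsurj] := omega1_setX_nat hW.
pose P : porderType _ := condition (fun s => V s && prefix p s).
(* An index codes a member of the family [D] together with a length. Asking [D] only of an initial
   segment lets [q] be lengthened freely. *)
pose E b : set P := [set q | (f b).2 <= size (val q) /\
                             exists n, D (f b).1 (take n (val q))].
have Pn : [set: P] !=set0.
  by exists (exist _ p (introT andP (conj Vp (prefix_refl p)))).
have Ed b : poset_dense (E b).
  move=> [q qP]; have /andP[Vq pq] := qP.
  have [r [Vr qr Dr]] := Dd (f b).1 q Vq.
  have [s [Vs rs bs]] := ext_size (f b).2 Vr.
  have Ps : V s && prefix p s.
    by rewrite Vs (prefix_trans pq) // (prefix_trans qr).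
  exists (exist _ s Ps); last exact: prefix_trans rs.
  split=> //; exists (size r) => /=.
  by move: rs; rewrite prefixE => /eqP ->.
have [G [Gn Gup Gdir] GE] := hMA Pn (countableP _) Ed.
have [x0 _] := Vrcons Vp.
have [w0 _] := omega1_inh.
have /choice[u uP] n : exists q : P, G q /\ n < size (val q).
  have [b fb] := fsurj (w0, n.+1); have [q [Gq [nq _]]] := GE b.
  by exists q; rewrite fb in nq.
(* By directedness of [G] the value does not depend on the choice of [u n]. *)
pose g n := nth x0 (val (u n)) n.
have gG q : G q -> mkseq g (size (val q)) = val q.
  move=> Gq; apply: (@eq_from_nth _ x0); rewrite size_mkseq // => i iq.
  have [Gu iu] := uP i; have [r [_ rq ru]] := Gdir _ _ Gq Gu.
  by rewrite nth_mkseq // /g -(prefix_nth _ iu ru) (prefix_nth _ iq rq).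
exists g; split.
- move=> n; have [Gu nu] := uP n.
  have -> : mkseq g n = take n (val (u n)).
    by rewrite -(gG _ Gu) -map_take take_iota (minn_idPl (ltnW nu)).
  by apply: Vtake; have /andP[] := valP (u n).
- have [q Gq] := Gn; have /andP[_ pq] := valP q.
  have := gG q Gq; move: pq; rewrite prefixE => /eqP pq gq.
  rewrite -[RHS]pq -gq -map_take take_iota (minn_idPl _) //.
  by rewrite -{1}pq size_take_min geq_minr.
- move=> b; have [c fc] := fsurj (b, 0).
  have [q [Gq [_ [n]]]] := GE c; rewrite fc => Dq.
  (* If [n] exceeds the length of [q], [take n] returns all of [q]. *)
  exists (minn n (size (val q))).
  by move: Dq => /=; rewrite -{1}(gG _ Gq) -map_take take_iota.
Qed.

(** The analogue of comeager, with aleph_1 dense sets of conditions. *)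
Definition large (A : set (nat -> T)) : Prop :=
  exists2 D : W -> set (seq T), forall b, dense_in (D b) &
    forall g, branch g -> (forall b, exists n, D b (mkseq g n)) -> A g.

Lemma large_ex A p : V p -> large A ->
  exists g, [/\ branch g, mkseq g (size p) = p & A g].
Proof.
move=> Vp [D Dd DA]; have [g [bg pg gD]] := generic_branch Vp Dd.
by exists g; split=> //; exact: DA.
Qed.

Lemma large_sub A B : (forall g, branch g -> A g -> B g) -> large A -> large B.
Proof.
by move=> AB [D Dd DA]; exists D => // g bg gD; apply: AB => //; exact: DA.
Qed.

Lemma large_dense D : dense_in D -> large [set g | exists n, D (mkseq g n)].
Proof.
by move=> Dd; exists (fun=> D) => // g bg gD; have [w _] := omega1_inh; exact: gD w.
Qed.

(** A surjection of [W] onto [W * W] merges the aleph_1 families of dense sets into one. *)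
Lemma large_forall (A : W -> set (nat -> T)) :
  (forall b, large (A b)) -> large [set g | forall b, A b g].
Proof.
move=> lA; have [f fsurj] := omega1_setX hW.
have /choice[D DP] b : exists D : W -> set (seq T), (forall c, dense_in (D c)) /\
    forall g, branch g -> (forall c, exists n, D c (mkseq g n)) -> A b g.
  by have [D] := lA b; exists D.
exists (fun w => D (f w).1 (f w).2) => [w|g bg gD b]; first by have [] := DP (f w).1.
have [_] := DP b; apply => // c; have [w fw] := fsurj (b, c).
by have := gD w; rewrite fw.
Qed.

Lemma large_forall_count (I : countType) (A : I -> set (nat -> T)) :
  (forall i, large (A i)) -> large [set g | forall i, A i g].
Proof.
move=> lA; have [f fsurj] := omega1_setX_nat hW; have [w0 _] := omega1_inh.
have largeT : large setT.
  apply: (large_sub (A := [set g | exists n, setT (mkseq g n)])) => //.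
  by apply: large_dense => p Vp; exists p; rewrite prefix_refl.
(* Indices that decode to nothing receive the full set. *)
pose B w : set (nat -> T) := if unpickle (f w).2 is Some i then A i else setT.
apply: (large_sub (A := [set g | forall w, B w g])).
  move=> g _ gB i; have [w fw] := fsurj (w0, pickle i).
  by have := gB w; rewrite /B fw pickleK.
by apply: large_forall => w; rewrite /B; case: unpickle.
Qed.

(** Forcing is defined through generic branches rather than by recursion, so it commutes with
    [W]-indexed intersections. *)
Definition forces (p : seq T) (A : set (nat -> T)) : Prop :=
  large [set g | mkseq g (size p) = p -> A g].

Lemma mkseq_prefix (g : nat -> T) p n :
  size p <= n -> prefix p (mkseq g n) -> mkseq g (size p) = p.
Proof.
by move=> pn; rewrite prefixE -map_take take_iota (minn_idPl pn) => /eqP.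
Qed.

Lemma prefix_mkseq (g : nat -> T) p q :
  prefix p q -> mkseq g (size q) = q -> mkseq g (size p) = p.
Proof.
by move=> pq gq; apply: (@mkseq_prefix _ _ (size q)); rewrite ?gq // size_prefix.
Qed.

Lemma forces_sub p A B : (forall g, A g -> B g) -> forces p A -> forces p B.
Proof. by move=> AB; apply: large_sub => g _ + pg => /(_ pg)/AB. Qed.

Lemma forces_all p A :
  (forall g, branch g -> mkseq g (size p) = p -> A g) -> forces p A.
Proof.
move=> pA; apply: (large_sub (A := [set g | exists n, setT (mkseq g n)])).
  by move=> g bg _; exact: pA.
by apply: large_dense => q Vq; exists q; rewrite prefix_refl.
Qed.

Lemma forces_extend p q A : prefix p q -> forces p A -> forces q A.
Proof. by move=> pq; apply: large_sub => g _ + gq; apply; exact: prefix_mkseq gq. Qed.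

Lemma forces_forall p (A : W -> set (nat -> T)) :
  (forall b, forces p (A b)) -> forces p [set g | forall b, A b g].
Proof.
by move=> pA; apply: large_sub (large_forall pA) => g _ + pg b; apply.
Qed.

(** Otherwise a large set would contain no branch through [p], against the axiom. *)
Lemma forces_consistent p A : V p -> forces p A -> ~ forces p (~` A).
Proof.
move=> Vp pA pnA.
have lA : large [set g | forall b : bool,
    mkseq g (size p) = p -> if b then A g else ~ A g].
  by apply: large_forall_count => -[].
have [g [_ pg gA]] := large_ex Vp lA.
exact: gA false pg (gA true pg).
Qed.

(* A set forced densely below [p] is forced by [p]: countably many conditions
   witness this, so their largeness witnesses can be met simultaneously. *)
Lemma forces_densely p A :
  (forall q, V q -> prefix p q -> exists r, [/\ V r, prefix q r & forces r A]) ->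
  forces p A.
Proof.
move=> pA.
pose D : set (seq T) := [set r | prefix p r -> forces r A].
(* The length bound makes an initial segment of [g] lying in this set extend [p] as soon as [g]
   passes through [p]. *)
have Dd : dense_in [set r | size p <= size r /\ D r].
  move=> q /(ext_size (size p))[q' [Vq' qq' pq']].
  have [pq|npq] := boolP (prefix p q').
    have [r [Vr q'r rA]] := pA q' Vq' pq; exists r; split=> //.
      exact: prefix_trans q'r.
    by split=> //; rewrite (leq_trans pq') // size_prefix.
  by exists q'; split=> //; split=> //; rewrite /D /= (negPf npq).
have lA : large [set g | forall r, forces r A -> mkseq g (size r) = r -> A g].
  apply: large_forall_count => r; have [rA|nrA] := pselect (forces r A).
    by apply: large_sub rA => g _ gA _.
  by apply: large_sub (large_dense Dd) => g _ _ /nrA.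
have l2 : large [set g | forall b : bool, if b
    then forall r, forces r A -> mkseq g (size r) = r -> A g
    else exists n, [set r | size p <= size r /\ D r] (mkseq g n)].
  by apply: large_forall_count => -[] //; exact: large_dense.
apply: large_sub l2 => g _ gP pg.
have [n [+ Dn]] := gP false; rewrite size_mkseq => pn.
apply: (gP true (mkseq g n)); last by rewrite size_mkseq.
by apply: Dn; rewrite prefixE -map_take take_iota (minn_idPl pn) -/(mkseq g _) pg.
Qed.

(** Plays the role of the Baire property. *)
Definition decidable_by_forcing (A : set (nat -> T)) : Prop :=
  forall p, V p -> exists q, [/\ V q, prefix p q & forces q A \/ forces q (~` A)].

Lemma decidableC A : decidable_by_forcing A -> decidable_by_forcing (~` A).
Proof.
move=> dA p /dA[q [Vq pq qA]]; exists q; split=> //.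
by rewrite setCK; case: qA; [right | left].
Qed.

(** If no extension forced the complement, conditions forcing [A] would be dense below [p]. *)
Lemma not_forces p A : decidable_by_forcing A -> ~ forces p A ->
  exists q, [/\ V q, prefix p q & forces q (~` A)].
Proof.
move=> dA npA; apply: contrapT => nq; apply/npA/forces_densely => q Vq pq.
have [r [Vr qr [rA|rA]]] := dA q Vq; first by exists r.
by case: nq; exists r; split=> //; exact: prefix_trans qr.
Qed.

(** Either some extension refutes one [A b], or [p] already forces each of them by [not_forces]. *)
Lemma decidable_forall (A : W -> set (nat -> T)) :
  (forall b, decidable_by_forcing (A b)) ->
  decidable_by_forcing [set g | forall b, A b g].
Proof.
move=> dA p Vp.
have [[b [q [Vq pq qA]]]|np] :=
  pselect (exists b q, [/\ V q, prefix p q & forces q (~` A b)]).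
  by exists q; split=> //; right; apply: forces_sub qA => g nA /(_ b).
exists p; split=> //; first exact: prefix_refl.
left; apply: forces_forall => b; apply: contrapT => /(not_forces (dA b))[q qP].
by apply: np; exists b, q.
Qed.

End GenericBranches.

(** * Tags and retagging *)

(* [Some (b, n)] stands for the ordinal [omega * b + n] and [None] for
   infinity, which lies below itself. *)
Definition otag (W : Type) : Type := option (W * nat).

Section Tags.
Context {W : Type} (R : rel W) (hW : is_omega1 R).

Definition otag_lt (t u : otag W) : Prop :=
  match t, u with
  | _, None => True
  | None, Some _ => False
  | Some (b, m), Some (c, n) => ord_lt R b c \/ b = c /\ m < n
  end.

(** As ordinals, this and the next two conditions read: at least [omega * (c + 1)], at least
    [omega * c], below [omega * (c + 1)]; infinity satisfies all three. *)
Definition otag_above (c : W) (t : otag W) : Prop :=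
  if t is Some (b, _) then ord_lt R c b else True.

Definition otag_from (c : W) (t : otag W) : Prop :=
  if t is Some (b, _) then R c b else True.

Definition otag_upto (c : W) (t : otag W) : Prop :=
  if t is Some (b, _) then R b c else True.

Lemma otag_lt_trans t u v : otag_lt t u -> otag_lt u v -> otag_lt t v.
Proof.
case: t u v => [[b m]|] [[c n]|] [[e k]|] //= [bc|[-> mn]] [ce|[<- nk]].
- by left; apply: (omega1_le_lt_trans hW) ce; have [] := bc.
- by left.
- by left.
- by right; split=> //; exact: ltn_trans nk.
Qed.

Lemma otag_nlt_lt t c k u : ~ otag_lt t (Some (c, k)) -> otag_lt t u ->
  otag_lt (Some (c, k)) u.
Proof.
case: t u => [[b m]|] [[e n]|] //= nbc be.
have cb : R c b by apply: contrapT => /(omega1_ltNge hW) bc; apply: nbc; left.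
case: be => [be|[<- mn]]; first by left; exact: (omega1_le_lt_trans hW) be.
have [cb'|ncb] := pselect (c = b); last by left.
right; split=> //; rewrite -cb' in nbc.
by apply: leq_ltn_trans mn; rewrite leqNgt; apply/negP => mk; apply: nbc; right.
Qed.

(** Finite tags are ordered lexicographically, and infinity is never below one of them. *)
Lemma otag_acc t : t <> None -> Acc otag_lt t.
Proof.
case: t => [[b n] _|/(_ erefl)[]].
move: b n; apply: (well_founded_ind (omega1_wf hW)) => b IHb; elim/ltn_ind => n IHn.
by constructor=> -[[c m]|[]] [cb|[-> mn]]; [exact: IHb | exact: IHn].
Qed.

(** The minimum of [t] and [omega * c + k]. *)
Definition otag_cap (c : W) (t : otag W) (k : nat) : otag W :=
  if `[< otag_lt t (Some (c, k)) >] then t else Some (c, k).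

Lemma otag_cap_lt c t k u : otag_lt t u -> otag_lt (otag_cap c t k) u.
Proof. by rewrite /otag_cap; case: asboolP => // nt; exact: otag_nlt_lt. Qed.

Lemma otag_cap_lt_base c t k l : k < l -> otag_lt (otag_cap c t k) (Some (c, l)).
Proof.
move=> kl; rewrite /otag_cap; case: asboolP => [tk|_]; last by right.
by apply: otag_lt_trans tk _; right.
Qed.

Lemma otag_cap_lt_cap c t k u l : otag_lt t u -> k < l ->
  otag_lt (otag_cap c t k) (otag_cap c u l).
Proof.
move=> tu kl; rewrite {2}/otag_cap; case: asboolP => _; first exact: otag_cap_lt.
exact: otag_cap_lt_base.
Qed.

Lemma otag_cap_lt_above c t k u : otag_above c u -> otag_lt (otag_cap c t k) u.
Proof.
move=> cu; apply: otag_lt_trans (otag_cap_lt_base c t (ltnSn k)) _.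
by case: u cu => [[b n]|] //=; left.
Qed.

Lemma otag_cap_upto c s t k : R c s -> otag_upto s t -> otag_upto s (otag_cap c t k).
Proof. by rewrite /otag_cap; case: ifP. Qed.

(** Capping alters only tags from [omega * c] on and keeps them there, so similarity up to
    [otag_from c] does not see it. *)
Lemma otag_cap_from c t k :
  otag_cap c t k = t \/ otag_from c t /\ otag_from c (otag_cap c t k).
Proof.
rewrite /otag_cap; case: asboolP => [_|nt]; [by left | right; split].
  case: t nt => [[b m]|] //= nt; apply: contrapT => /(omega1_ltNge hW) bc.
  by apply: nt; left.
exact: omega1_refl.
Qed.

(** Coding tags by natural numbers makes conditions finite sequences over [nat * nat], hence
    countable in number. *)
Lemma otag_enum s : exists dec : nat -> otag W,
  (forall n, otag_upto s (dec n)) /\ forall t, otag_upto s t -> exists n, dec n = t.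
Proof.
have [_ _ /(_ s) /countable_injP[g ginj]] := hW.
have /choice[e eP] n : exists b, R b s /\ ((exists2 b', R b' s & g b' = n) -> g b = n).
  have [[b bc gb]|nb] := pselect (exists2 b, R b s & g b = n); first by exists b.
  by exists s; split=> //; exact: omega1_refl.
exists (fun n => omap (fun z => (e z.1, z.2))
  (odflt None (unpickle n : option (option (nat * nat))))).
split=> [n|].
  by case: unpickle => [[[k m]|]|] //=; have [] := eP k.
case=> [[b m]|_]; last by exists (pickle (None : option (nat * nat))); rewrite pickleK.
move=> bs; exists (pickle (Some (g b, m))); rewrite pickleK /=; congr (Some (_, _)).
have [es /(_ _)] := eP (g b); move=> h; apply: ginj; rewrite ?inE //.
by apply: h; exists b.
Qed.

End Tags.

Arguments otag_lt : simpl never.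

(** * Ranked forests as forcing conditions *)

Section RankedForests.
Context {W : Type} (R : rel W) (hW : is_omega1 R).
Context (s : W) (dec : nat -> otag W).
Hypothesis dec_upto : forall n, otag_upto R s (dec n).
Hypothesis dec_surj : forall t, otag_upto R s t -> exists n, dec n = t.

Local Notation d0 := (0, 0).

(* A condition lists, for each node [j], a parent and the code of a tag; a node
   whose listed parent is not a smaller number is a root. *)
Definition ranked (p : seq (nat * nat)) : bool :=
  `[< forall j, j < size p -> (nth d0 p j).1 < j ->
      otag_lt R (dec (nth d0 p j).2) (dec (nth d0 p (nth d0 p j).1).2) >].

Lemma ranked_take n p : ranked p -> ranked (take n p).
Proof.
move=> /asboolP Vp; apply/asboolP => j; rewrite size_take_min leq_min.
move=> /andP[jn jp]; rewrite (nth_take _ jn) => ij.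
by rewrite (nth_take _ (ltn_trans ij jn)); exact: Vp.
Qed.

Lemma ranked_rcons p x : ranked p ->
  (x.1 < size p -> otag_lt R (dec x.2) (dec (nth d0 p x.1).2)) ->
  ranked (rcons p x).
Proof.
move=> /asboolP Vp Vx; apply/asboolP => j; rewrite size_rcons ltnS leq_eqVlt.
move=> /predU1P[->|jp].
  by rewrite nth_rcons ltnn eqxx => xp; rewrite nth_rcons xp; exact: Vx.
by rewrite nth_rcons jp => ij; rewrite nth_rcons (ltn_trans ij jp); exact: Vp.
Qed.

Lemma ranked_ext p : ranked p -> exists x, ranked (rcons p x).
Proof. by move=> Vp; exists (size p, 0); apply: ranked_rcons; rewrite ?ltnn. Qed.

Lemma branch_ranked g : branch ranked g -> forall j, (g j).1 < j ->
  otag_lt R (dec (g j).2) (dec (g (g j).1).2).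
Proof.
move=> /(_ _.+1) bg j ij; have /asboolP/(_ j) := bg j.
rewrite size_mkseq (nth_mkseq _ _ (ltnSn j)) (nth_mkseq _ _ (ltn_trans ij (ltnSn j))).
exact.
Qed.

(** Same edges, and same tags except where both tags satisfy [P]. Past the common length both sides
    read the default [d0]. *)
Definition similar (P : otag W -> Prop) (p q : seq (nat * nat)) : Prop :=
  size p = size q /\ forall j, (nth d0 p j).1 = (nth d0 q j).1 /\
    (dec (nth d0 p j).2 = dec (nth d0 q j).2 \/
     P (dec (nth d0 p j).2) /\ P (dec (nth d0 q j).2)).

Lemma similar_sym P p q : similar P p q -> similar P q p.
Proof.
move=> [spq h]; split=> // j; have [-> [->|[]]] := h j; split=> //.
  by left.
by right.
Qed.

Lemma similar_sub (P Q : otag W -> Prop) p q :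
  (forall t, P t -> Q t) -> similar P p q -> similar Q p q.
Proof.
move=> PQ [spq h]; split=> // j; have [-> [->|[]]] := h j; split=> //.
  by left.
by right; split; exact: PQ.
Qed.

(* New nodes keep their tags, capped by [(c, k)] with [k] decreasing along [q']:
   below a node on which [p] and [p'] disagree any capped tag is small enough. *)
Lemma retag c p p' q : R c s -> ranked p -> ranked p' ->
  similar (otag_above R c) p p' -> ranked q -> prefix p q ->
  exists q', [/\ ranked q', prefix p' q' & similar (otag_from R c) q q'].
Proof.
move=> cs /asboolP Vp /asboolP Vp' [spp' pp'] /asboolP Vq pq.
pose cap j := otag_cap R c (dec (nth d0 q j).2) (size q - j).
have /choice[enc encP] j : exists n, dec n = cap j.
  by apply: dec_surj; apply: otag_cap_upto.
pose h j := if j < size p then nth d0 p' j else ((nth d0 q j).1, enc j).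
have hq j : j < size q -> nth d0 (mkseq h (size q)) j = h j.
  by move=> jq; rewrite nth_mkseq.
have sp : size p <= size q by exact: size_prefix.
have qp j : j < size p -> nth d0 q j = nth d0 p j.
  by move=> jp; exact: prefix_nth.
have h1 j : (h j).1 = (nth d0 q j).1.
  by rewrite /h; case: ifP => // jp; rewrite qp //; have [->] := pp' j.
exists (mkseq h (size q)); split.
- apply/asboolP => j; rewrite size_mkseq => jq; rewrite hq // h1 => ij.
  have := Vq j jq ij; set i := (nth d0 q j).1 in ij *; move=> qji.
  rewrite (hq _ (ltn_trans ij jq)) /h.
  (* An edge from [j] to its parent [i]: if both are old, [p'] is valid; if both are new, the caps
     decrease; if only [i] is old, its tag is either unchanged, and capping [j] is harmless, or
     above every capped tag. *)
  case: ifP => jp.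
    rewrite (ltn_trans ij jp).
    have -> : i = (nth d0 p' j).1 by rewrite /i qp //; have [->] := pp' j.
    apply: Vp'; rewrite -?spp' //.
    by have [<- _] := pp' j; rewrite -qp.
  case: ifP => ip /=; rewrite !encP; last first.
    by apply: (otag_cap_lt_cap hW) => //; apply: ltn_sub2l => //; exact: ltn_trans jq.
  have [_ [pi|[_ pi]]] := pp' i; last exact: (otag_cap_lt_above hW).
  by rewrite -pi -qp //; exact: (otag_cap_lt hW).
- rewrite prefixE; apply/eqP/(@eq_from_nth _ d0) => [|i].
    by rewrite size_take_min size_mkseq -spp' (minn_idPl sp).
  rewrite size_take_min size_mkseq => /leq_trans/(_ (geq_minl _ _)) ip'.
  have ip : i < size p by rewrite spp'.
  by rewrite nth_take // hq ?(leq_trans ip) // /h ip.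
- split; first by rewrite size_mkseq.
  move=> j; have [jq|qj] := ltnP j (size q); last first.
    by rewrite !nth_default ?size_mkseq //; split=> //; left.
  rewrite hq // h1; split=> //; rewrite /h; case: ifP => jp.
    rewrite qp //; have [_ [->|[cp cp']]] := pp' j; [by left|right].
    by split; [move: cp|move: cp']; case: (dec _) => [[b n]|] //= [].
  rewrite /= encP /cap;
  have [->|] := otag_cap_from hW c (dec (nth d0 q j).2) (size q - j).
    by left.
  by right.
Qed.

End RankedForests.

(** * Topology of Cantor space *)

Lemma clopen_cantor (A : set cantor_space) (x : cantor_space) : clopen A ->
  exists n, forall y : cantor_space, (forall k, k < n -> y k = x k) -> (A y <-> A x).
Proof.
have key (B : set cantor_space) : open B -> B x ->
    exists n, forall y : cantor_space, (forall k, k < n -> y k = x k) -> B y.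
  move=> oB Bx; apply: contrapT => nB.
  (* Points outside [B] agreeing with [x] on ever longer initial segments would converge to [x]. *)
  have /choice[z zP] n : exists y : cantor_space, (forall k, k < n -> y k = x k) /\ ~ B y.
    apply: contrapT => ny; apply: nB; exists n => y yx.
    by apply: contrapT => nBy; apply: ny; exists y.
  have zx : z n @[n --> \oo] --> x.
    apply/(@pointwise_cvgP nat bool) => k; apply: cvg_near_cst.
    by exists k.+1 => // n /= kn; have [-> //] := zP n.
  have [N _ NB] := zx _ (open_nbhs_nbhs (conj oB Bx)).
  by have [_] := zP N; apply; apply: (NB N) => /=.
move=> [oA /closed_openC oAC]; have [Ax|nAx] := pselect (A x).
  by have [n nP] := key A oA Ax; exists n => y /nP.
by have [n nP] := key _ oAC nAx; exists n => y /nP.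
Qed.

Lemma is_borelC (T : ptopologicalType) (B : set T) : is_borel B -> is_borel (~` B).
Proof. exact: sigma_algebraC. Qed.

Lemma is_borel_bigcup (T : ptopologicalType) (B : nat -> set T) :
  (forall n, is_borel (B n)) -> is_borel (\bigcup_n B n).
Proof. exact: sigma_algebra_bigcup. Qed.

Lemma is_borel_bigcap (T : ptopologicalType) (B : nat -> set T) :
  (forall n, is_borel (B n)) -> is_borel (\bigcap_n B n).
Proof.
move=> bB; rewrite -[X in is_borel X]setCK setC_bigcap; apply: is_borelC.
by apply: is_borel_bigcup => n; exact: is_borelC.
Qed.

Lemma is_borel_cst (T : ptopologicalType) (P : Prop) : is_borel [set _ : T | P].
Proof.
apply: sub_sigma_algebra => /=; have [p|np] := pselect P.
  by rewrite (_ : [set _ | _] = setT); [exact: openT | apply/seteqP; split].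
by rewrite (_ : [set _ | _] = set0); [exact: open0 | apply/seteqP; split].
Qed.

Lemma is_borelU (T : ptopologicalType) (A B : set T) :
  is_borel A -> is_borel B -> is_borel (A `|` B).
Proof.
move=> bA bB; rewrite -bigcup2E; apply: is_borel_bigcup => -[|[|n]] //=.
exact: (@is_borel_cst _ False).
Qed.

Lemma is_borel_proj (k : nat) : is_borel [set x : cantor_space | x k].
Proof.
apply: sub_sigma_algebra => /=.
have cf : continuous (fun x : cantor_space => x k).
  exact: (@proj_continuous nat (fun=> bool) k).
rewrite (_ : mkset _ = (fun x : cantor_space => x k) @^-1` [set true]) //.
exact: (continuousP _).1 cf _ (discrete_open [set true]).
Qed.

(** * Omega_1-Borel sets of forests *)

Section StarComplements.
Context {W : Type} {R : rel W} (hW : is_omega1 R).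

Lemma SigmaStar_cases a A : SigmaStar R a A ->
  ord_zero R a /\ clopen A \/ ~ ord_zero R a /\
  exists2 F : W -> set cantor_space, A = \bigcup_b F b &
    forall b, exists2 c, ord_lt R c a & PiStar R c (F b).
Proof. by case=> {}a {}A a0 hA; [left | right; split=> //; exists A]. Qed.

Lemma PiStar_cases a A : PiStar R a A ->
  ord_zero R a /\ clopen A \/ ~ ord_zero R a /\
  exists2 F : W -> set cantor_space, A = \bigcap_b F b &
    forall b, exists2 c, ord_lt R c a & SigmaStar R c (F b).
Proof. by case=> {}a {}A a0 hA; [left | right; split=> //; exists A]. Qed.

Lemma clopen_setC (T : topologicalType) (A : set T) : clopen A -> clopen (~` A).
Proof. by move=> [oA cA]; split; [exact: closed_openC | exact: open_closedC]. Qed.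

Lemma StarC a A : (SigmaStar R a A -> PiStar R a (~` A)) /\
                  (PiStar R a A -> SigmaStar R a (~` A)).
Proof.
move: a A; apply: (well_founded_ind (omega1_wf hW)) => a IH A; split.
- move=> /SigmaStar_cases[[a0 /clopen_setC cA]|[na0 [F -> hF]]]; first exact: PiStar0.
  rewrite setC_bigcup; apply: PiStarI => // b; have [c ca hc] := hF b.
  by exists c => //; apply: (IH c ca _).2.
- move=> /PiStar_cases[[a0 /clopen_setC cA]|[na0 [F -> hF]]]; first exact: SigmaStar0.
  rewrite setC_bigcap; apply: SigmaStarU => // b; have [c ca hc] := hF b.
  by exists c => //; apply: (IH c ca _).1.
Qed.

End StarComplements.

(** Bit [(i, j)] says that [i] is the parent of [j]. Tags leave no trace in the code. *)
Definition forest (g : nat -> nat * nat) : cantor_space := fun k =>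
  if (unpickle k : option (nat * nat)) is Some (i, j)
  then (i < j) && ((g j).1 == i) else false.

Lemma forest_edge g i j : forest g (pickle (i, j)) = (i < j) && ((g j).1 == i).
Proof. by rewrite /forest pickleK. Qed.

Lemma clopen_forest (A : set cantor_space) g : clopen A ->
  exists n, forall g', (forall j, j < n -> (g' j).1 = (g j).1) ->
    (A (forest g') <-> A (forest g)).
Proof.
move=> /(clopen_cantor (forest g))[n nP].
(* Bit [k] depends only on the parent of one node [j]; the successor makes the bound strict. *)
pose idx k := if (unpickle k : option (nat * nat)) is Some (_, j) then j.+1 else 0.
exists (\max_(k < n) idx k) => g' g'g; apply: nP => k kn; rewrite /forest.
case E : unpickle => [[i j]|] //; rewrite g'g //.
apply: leq_trans (@leq_bigmax _ (fun k : 'I_n => idx k) (Ordinal kn)).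
by rewrite /idx /= E.
Qed.

(** * Ranks of nodes: Borel complexity and agreement with tags *)

Section TreeRanks.
Context {W : Type} (R : rel W) (hW : is_omega1 R) (dec : nat -> otag W).

(** For a finite tag [dec n], with [dec] listing all smaller tags, this bounds the rank of node [i]
    by that ordinal. *)
Inductive rank_le (x : cantor_space) : nat -> nat -> Prop :=
| RankLe n i : (forall j, x (pickle (i, j)) ->
      exists m, otag_lt R (dec m) (dec n) /\ rank_le x m j) -> rank_le x n i.

Lemma rank_leP x n i : rank_le x n i <-> (forall j, x (pickle (i, j)) ->
  exists m, otag_lt R (dec m) (dec n) /\ rank_le x m j).
Proof. by split=> [[]|]; last exact: RankLe. Qed.

(** Unfolding one level gives a countable intersection over children of countable unions over
    smaller tags; induction on the tag. *)
Lemma rank_le_borel n i : Acc (otag_lt R) (dec n) -> is_borel [set x | rank_le x n i].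
Proof.
move En : (dec n) => t acct.
elim: acct n i En => {}t _ IH n i En.
pose F j m : set cantor_space :=
  if `[< otag_lt R (dec m) (dec n) >] then [set x | rank_le x m j] else set0.
rewrite (_ : mkset _ =
    \bigcap_j (~` [set x : cantor_space | x (pickle (i, j))] `|`
               \bigcup_m F j m)); last first.
  apply/seteqP; split=> x /=; rewrite rank_leP => h.
    move=> j _; have [/h[m [mn xm]]|nx] := pselect (x (pickle (i, j))); last by left.
    by right; exists m => //; rewrite /F; case: asboolP.
  move=> j xj; case: (h j I) => [//|[m _]].
  by rewrite /F; case: asboolP => // mn xm; exists m.
apply: is_borel_bigcap => j; apply: is_borelU.
  by apply: is_borelC; apply: is_borel_proj.
apply: is_borel_bigcup => m; rewrite /F; case: asboolP => mn.
  by apply: (IH (dec m)) => //; rewrite -En.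
exact: (@is_borel_cst _ False).
Qed.

(** Tags decrease along edges, so each child's own tag witnesses the bound. *)
Lemma branch_rank_le g i : branch (ranked R dec) g -> Acc (otag_lt R) (dec (g i).2) ->
  rank_le (forest g) (g i).2 i.
Proof.
move=> bg; move Et : (dec (g i).2) => t acct.
elim: acct i Et => {}t _ IH i Et; apply: RankLe => j.
rewrite forest_edge => /andP[ij /eqP gj].
have ji : otag_lt R (dec (g j).2) (dec (g i).2).
  by have := branch_ranked bg (j := j); rewrite gj; exact.
exists (g j).2; split=> //; apply: (IH (dec (g j).2)) => //.
by rewrite -Et.
Qed.

(** The pair [z] is a prospective parent and tag code: every node has a child with each smaller
    tag. *)
Definition saturated (g : nat -> nat * nat) : Prop :=
  forall z : nat * nat, otag_lt R (dec z.2) (dec (g z.1).2) ->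
    exists2 j, z.1 < j & g j = z.

(** Some child carries the tag [dec m] itself; a bound [dec m] at [i] would give that child a bound
    below its own tag, an infinite descent. *)
Lemma saturated_rank_le g m i : saturated g -> Acc (otag_lt R) (dec m) ->
  otag_lt R (dec m) (dec (g i).2) -> ~ rank_le (forest g) m i.
Proof.
move=> sg; move Et : (dec m) => t acct.
elim: acct m i Et => {}t _ IH m i Et mi /rank_leP h.
have [|j /= ij gj] := sg (i, m); first by rewrite /= Et.
have [|k [km jk]] := h j; first by rewrite forest_edge ij gj /=.
by apply: (IH (dec k)) jk; rewrite ?gj -?Et.
Qed.

Lemma large_saturated : large W (ranked R dec) saturated.
Proof.
pose D (z : nat * nat) : set (seq (nat * nat)) := [set p | z.1 < size p /\
  (otag_lt R (dec z.2) (dec (nth (0, 0) p z.1).2) ->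
   exists2 j, j < size p & z.1 < j /\ nth (0, 0) p j = z)].
apply: (large_sub (A := [set g | forall z, exists n, D z (mkseq g n)])).
  move=> g _ gD z zg; have [n [+ h]] := gD z; rewrite size_mkseq => zn.
  move: h; rewrite nth_mkseq // size_mkseq => /(_ zg)[j jn [zj]].
  by rewrite nth_mkseq // => gj; exists j.
apply: (large_forall_count hW) => z; apply: (large_dense hW) => p Vp.
(* First make node [z.1] exist; then [z] can be appended as its child. *)
have [q [Vq pq zq]] := ext_size (@ranked_ext _ R dec) z.1.+1 Vp.
have [zlt|nz] := pselect (otag_lt R (dec z.2) (dec (nth (0, 0) q z.1).2)); last first.
  by exists q.
exists (rcons q z); split.
- exact: ranked_rcons.
- by apply: prefix_trans pq _; exact: prefix_rcons.
- split; rewrite size_rcons; first exact: ltnW.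
  by move=> _; exists (size q) => //; rewrite nth_rcons ltnn eqxx.
Qed.

End TreeRanks.

(** * Forcing of [Pi*_c] sets is invariant under retagging *)

Section Invariance.
Context {W : Type} {R : rel W} (hW : is_omega1 R) (hMA : MA_ctble W).
Context (s : W) (dec : nat -> otag W).
Hypothesis dec_upto : forall n, otag_upto R s (dec n).
Hypothesis dec_surj : forall t, otag_upto R s t -> exists n, dec n = t.

Local Notation V := (ranked R dec).
Local Notation pull A := [set g | A (forest g)].

Let Vtake n p : V p -> V (take n p) := @ranked_take _ _ _ n p.
Let Vext p : V p -> exists x, V (rcons p x) := @ranked_ext _ _ _ p.

Lemma clopen_decidable A : clopen A -> decidable_by_forcing W V (pull A).
Proof.
move=> cA p Vp.
have [|g [bg pg _]] := large_ex hW hMA Vtake Vext (A := setT) Vp.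
  (* Any large set yields a branch through [p]. *)
  apply: (large_sub (A := saturated R dec)) => //; exact: large_saturated.
have [n nP] := clopen_forest g cA; pose m := maxn n (size p).
exists (mkseq g m); split; first exact: bg.
  by rewrite prefixE -map_take take_iota (minn_idPl (leq_maxr _ _)) -/(mkseq g _) pg.
have agree g' : mkseq g' (size (mkseq g m)) = mkseq g m -> A (forest g') <-> A (forest g).
  rewrite size_mkseq => g'g; apply: nP => j jn.
  have jm : j < m by rewrite (leq_trans jn) // leq_maxl.
  by rewrite -(nth_mkseq (0, 0) g' jm) g'g nth_mkseq.
have [Ag|nAg] := pselect (A (forest g)); [left | right];
  by apply: (forces_all hW) => g' _ /agree/=; tauto.
Qed.

(** A branch through [p'] outside [A] has a long initial segment that retags to an extension of [p]
    with the same edges, and [A] sees only finitely many edges. *)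
Lemma clopen_invariant c A p p' : clopen A -> R c s -> V p -> V p' ->
  similar dec (otag_above R c) p p' ->
  forces W V p (pull A) -> forces W V p' (pull A).
Proof.
move=> cA cs Vp Vp' pp' pA; apply: contrapT => npA.
have [q' [Vq' p'q' nA]] := not_forces hW Vext (clopen_decidable cA) npA.
have [g [bg q'g nAg]] := large_ex hW hMA Vtake Vext Vq' nA.
have [n nP] := clopen_forest g cA; pose m := maxn n (size q').
have p'g : prefix p' (mkseq g m).
  apply: prefix_trans p'q' _.
  by rewrite prefixE -map_take take_iota (minn_idPl (leq_maxr _ _)) -/(mkseq g _) q'g.
have [r [Vr pr [gr sim]]] :=
  retag hW dec_upto dec_surj cs Vp' Vp (similar_sym pp') (bg m) p'g.
have rA : forces W V r (pull A) by exact: forces_extend pr pA.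
apply: (forces_consistent hW hMA Vtake Vext Vr rA).
apply: (forces_all hW) => h _ hr /=; rewrite nP; first exact: nAg.
move=> j jn; have jm : j < m by rewrite (leq_trans jn) // leq_maxl.
rewrite -gr size_mkseq in hr.
rewrite -(nth_mkseq (0, 0) h jm) hr; have [<- _] := sim j.
by rewrite nth_mkseq.
Qed.

(** If [p'] does not force some [F b], an extension forces its complement, a [Pi*_e] set with [e]
    below [c]. Retagged above [p], that extension still forces the complement by induction, yet [p]
    forces [F b]. *)
Lemma PiStar_forcing c A : PiStar R c A -> decidable_by_forcing W V (pull A) /\
  forall p p', R c s -> V p -> V p' -> similar dec (otag_above R c) p p' ->
    forces W V p (pull A) -> forces W V p' (pull A).
Proof.
move: c A; apply: (well_founded_ind (omega1_wf hW)) => c IH A.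
move=> hA; have {}hA := PiStar_cases hA. case: hA => -[c0].
  move=> cA; split; first exact: clopen_decidable.
  by move=> p p'; exact: clopen_invariant.
move=> [F AE hF].
have pullE : pull A = [set g | forall b, pull (F b) g].
  by rewrite AE; apply/seteqP; split=> g /= h b; [exact: h | move=> _; exact: h].
have decF b : decidable_by_forcing W V (pull (F b)).
  have [e ec /(StarC hW _ _).1 Fe] := hF b.
  have [dFe _] := IH e ec _ Fe.
  by rewrite -[pull (F b)]setCK; exact: decidableC dFe.
have decA : decidable_by_forcing W V (pull A).
  by rewrite pullE; exact: (decidable_forall hW Vext).
split=> // p p' cs Vp Vp' pp' pA.
rewrite pullE; apply: (forces_forall hW) => b; apply: contrapT => npA.
have [q' [Vq' p'q' nA]] := not_forces hW Vext (decF b) npA.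
have [q [Vq pq sim]] := retag hW dec_upto dec_surj cs Vp' Vp (similar_sym pp') Vq' p'q'.
have [e ec /(StarC hW _ _).1 Fe] := hF b.
have [_ inv] := IH e ec _ Fe.
have qA : forces W V q (pull (F b)).
  apply: forces_extend pq _; move: pA; rewrite pullE; apply: forces_sub => g; exact.
apply: (forces_consistent hW hMA Vtake Vext Vq qA).
apply: inv Vq' Vq _ nA; first by apply: (omega1_trans hW) cs; have [] := ec.
(* Retagging weakens [otag_above c] to [otag_from c], which still implies [otag_above e]. *)
apply: similar_sub sim => -[[b' n]|] //= cb'.
exact: (omega1_lt_le_trans hW) ec cb'.
Qed.

End Invariance.

(** * A Borel set separating the tags [omega * s] and infinity *)

Theorem theorem9 (W : Type) (R : rel W) (hW : is_omega1 R) :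
  MA_ctble W ->
  forall a : W, exists B : set cantor_space, is_borel B /\ ~ SigmaStar R a B.
Proof.
(* With [s] above [a], both [(s, 0)] and infinity satisfy [otag_above a]. *)
move=> hMA a; have [s as_ _] := omega1_succ hW a.
have [dec [dec_upto dec_surj]] := otag_enum hW s.
have [ninf infE] := dec_surj None I.
have [nfin finE] := dec_surj (Some (s, 0)) (omega1_refl hW s).
have accfin : Acc (otag_lt R) (dec nfin) by apply: (otag_acc hW); rewrite finE.
exists [set x | rank_le R dec x nfin 0]; split; first exact: rank_le_borel.
move=> /(StarC hW _ _).1 /(PiStar_forcing hW hMA dec_upto dec_surj)[_ inv].
(* Node 0 lists itself as parent, hence is a root. *)
have Vroot n : ranked R dec [:: (0, n)] by apply/asboolP => -[|j] //=.
apply: (forces_consistent hW hMA (@ranked_take _ R dec) (@ranked_ext _ R dec) (Vroot nfin)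
  (A := [set g | rank_le R dec (forest g) nfin 0])).
  apply: (forces_all hW) => g bg /= [g0].
  by have := branch_rank_le (i := 0) bg; rewrite g0 /=; apply.
(* The complement is forced by the root tagged infinity and transfers to the root tagged
   [omega * s], which forces the set itself. *)
apply: (inv [:: (0, ninf)]); first by case: as_.
- exact: Vroot.
- exact: Vroot.
- split=> // -[|j] /=; last by split=> //; left.
  by rewrite infE finE; split=> //; right.
apply: large_sub (large_saturated hW dec) => g _ sg [g0] /=.
by apply: (saturated_rank_le (i := 0) sg accfin); rewrite g0 infE finE.
Qed.
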